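(* Let $G$ be a group of $K$-linear Markov type for some field $K$. Then $G$ is Noetherian. In particular, $G$ is finitely generated.
   Context: For a finite-dimensional $K$-vector space $A$, $A^G$ is the $K$-vector space of all maps $x \colon G \to A$, equipped with the prodiscrete topology (product topology with each factor $A$ discrete) and with the shift action $(gx)(h) = x(g^{-1}h)$. A linear subshift of $A^G$ is a closed $G$-invariant vector subspace of $A^G$. A subset $\Sigma \subset A^G$ is a subshift of finite type (SFT) if there exist a finite subset $D \subset G$ and a subset $P \subset A^D$ such that $\Sigma = \{x \in A^G : (g^{-1}x)|_D \in P \text{ for all } g \in G\}$. A group $G$ is of $K$-linear Markov type if, for every finite-dimensional vector space $A$ over $K$, every linear subshift $\Sigma \subset A^G$ is an SFT. A group is Noetherian if it satisfies the maximal condition on subgroups, i.e., every ascending sequence of subgroups eventually stabilizes (equivalently, all of its subgroups are finitely generated). *)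

(* Defs.v *)
From HB Require Import structures.
From mathcomp Require Import all_boot all_order all_algebra.
From mathcomp Require Import all_classical.
From mathcomp Require Import topology function_spaces.

Set Implicit Arguments.
Unset Strict Implicit.
Unset Printing Implicit Defensive.

Import GRing.Theory.

Local Open Scope classical_set_scope.

Definition is_subgroup (G : groupType) (H : set G) : Prop :=
  group_closed (mem H).

(* Maximal condition on subgroups, in its ascending-chain form. *)
Definition noetherian_group (G : groupType) : Prop :=
  forall H : nat -> set G,
    (forall n, is_subgroup (H n)) ->
    (forall n, H n `<=` H n.+1) ->
    exists N : nat, forall n : nat, (N <= n)%N -> H n = H N.

Definition finitely_generated_group (G : groupType) : Prop :=
  exists S : set G,
    finite_set S /\ smallest (@is_subgroup G) S = [set: G].

Definition shift (G : groupType) (A : Type) (g : G) (x : G -> A) : G -> A :=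
  fun h => x (g^-1 * h)%g.

(* Closedness is taken for the prodiscrete topology: [{ptws _ -> _}] is the
   product topology, and [discrete_topology A] is [A] as a discrete space. *)
Definition linear_subshift (K : fieldType) (G : groupType) (A : vectType K)
    (Sigma : set (G -> A)) : Prop :=
  [/\ closed (Sigma : set {ptws G -> discrete_topology A}),
      forall (g : G) (x : G -> A), Sigma x -> Sigma (shift g x)
    & GRing.submod_closed (mem Sigma)].

(* [sigL D x : D -> A] is the restriction of [x] to [D]. *)
Definition sft (G : groupType) (A : Type) (Sigma : set (G -> A)) : Prop :=
  exists (D : set G) (P : set (D -> A)),
    finite_set D /\
    Sigma = [set x | forall g : G, P (sigL D (shift g^-1%g x))].

Definition linear_markov_type (K : fieldType) (G : groupType) : Prop :=
  forall (A : vectType K) (Sigma : set (G -> A)),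
    linear_subshift Sigma -> sft Sigma.

(* Main.v *)
(* For a subgroup [H] of [G], the maps [G -> K] that are constant on the left
   cosets of [H] form a linear subshift. If it is of finite type with window
   [D], put [F := D^-1 D `&` H], a finite set. Every pattern seen through a
   translate of [D] by a map that is invariant under right translation by [F]
   extends to a map constant on the left cosets of [H]. Right invariance under
   [F] therefore implies right invariance under [H], and applying this to the
   indicator function of the subgroup generated by [F] shows that this subgroup
   is [H]. Hence every subgroup of [G] is finitely generated, including the
   union of any ascending chain. *)

Require Import Defs.
From mathcomp Require Import all_boot all_order all_algebra.
From mathcomp Require Import all_classical.
From mathcomp Require Import topology function_spaces.

Set Implicit Arguments.
Unset Strict Implicit.
Unset Printing Implicit Defensive.

Import GRing.Theory.

Local Open Scope classical_set_scope.

Definition directed_family (I T : Type) (F : I -> set T) : Prop :=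
  forall i j, exists k, F i `|` F j `<=` F k.

Lemma directed_family_chain (T : Type) (F : nat -> set T) :
  {homo F : m n / (m <= n)%N >-> m `<=` n} -> directed_family F.
Proof.
move=> homoF m n; exists (maxn m n); rewrite subUset.
by split; apply: homoF; rewrite (leq_maxl, leq_maxr).
Qed.

Lemma finite_subset_directed_bigcup (I : Type) (T : choiceType) (i0 : I)
    (F : I -> set T) (S : set T) :
  directed_family F -> finite_set S -> S `<=` \bigcup_i F i ->
  exists i, S `<=` F i.
Proof.
move=> dirF /finite_seqP[s ->]; elim: s => [|a s IHs] subF; first by exists i0.
have [|j sFj] := IHs; first by move=> b bs; apply: subF; rewrite /= inE bs orbT.
have [i _ Fia] := subF a (mem_head a s).
have [k Fijk] := dirF i j; exists k => b /=.
by rewrite inE => /predU1P[->|bs]; apply: Fijk; [left | right; exact: sFj].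
Qed.

Section Subgroups.
Variable G : groupType.
Implicit Types (H S : set G) (g h : G).

Lemma subgroup1 H : is_subgroup H -> H 1%g.
Proof. by case=> /set_mem. Qed.

Lemma subgroupV H g : is_subgroup H -> H g -> H g^-1%g.
Proof. by move=> /group_closedV HV /mem_set/HV/set_mem. Qed.

Lemma subgroupM H g h : is_subgroup H -> H g -> H h -> H (g * h)%g.
Proof.
by move=> /group_closedM HM /mem_set Hg /mem_set Hh; exact/set_mem/HM.
Qed.

Lemma subgroupMl H g h : is_subgroup H -> H g -> H (g * h)%g = H h.
Proof.
move=> sH Hg; apply/propext; split=> Hgh; last exact: subgroupM.
by rewrite -[h](mulKg g); apply: subgroupM => //; exact: subgroupV.
Qed.

Lemma subgroupMr H g h : is_subgroup H -> H h -> H (g * h)%g = H g.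
Proof.
move=> sH Hh; apply/propext; split=> Hgh; last exact: subgroupM.
by rewrite -[g](mulgK h); apply: subgroupM => //; exact: subgroupV.
Qed.

Lemma is_subgroup_setT : is_subgroup [set: G].
Proof. by split=> [|g h _ _]; rewrite inE. Qed.

Lemma is_subgroup_bigcap (I : Type) (D : set I) (F : I -> set G) :
  (forall i, D i -> is_subgroup (F i)) -> is_subgroup (\bigcap_(i in D) F i).
Proof.
move=> sF; split=> [|g h /set_mem Fg /set_mem Fh]; apply/mem_set => i Di.
  exact: subgroup1 (sF i Di).
by apply: subgroupM (sF i Di) (Fg i Di) (subgroupV (sF i Di) (Fh i Di)).
Qed.

Lemma is_subgroup_directed_bigcup (I : Type) (i0 : I) (F : I -> set G) :
  directed_family F -> (forall i, is_subgroup (F i)) ->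
  is_subgroup (\bigcup_i F i).
Proof.
move=> dirF sF; split=> [|g h /set_mem[i _ Fig] /set_mem[j _ Fjh]].
  by apply/mem_set; exists i0 => //; exact: subgroup1.
have [k Fijk] := dirF i j; apply/mem_set; exists k => //.
apply: subgroupM (sF k) (Fijk _ _) (subgroupV (sF k) (Fijk _ _)).
  by left.
by right.
Qed.

Definition generated_subgroup S : set G := smallest (@is_subgroup G) S.

Lemma is_subgroup_generated S : is_subgroup (generated_subgroup S).
Proof. by apply: is_subgroup_bigcap => H []. Qed.

Definition finitely_generated H : Prop :=
  exists S, finite_set S /\ generated_subgroup S = H.

Lemma noetherian_finitely_generated :
  (forall H, is_subgroup H -> finitely_generated H) -> noetherian_group G.
Proof.
move=> fg H sH subH.
have homoH : {homo H : m n / (m <= n)%N >-> m `<=` n}.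
  apply: homo_leq subH => [U|V U W]; first exact: subset_refl.
  exact: subset_trans.
have dirH := directed_family_chain homoH.
have [S [finS genS]] := fg _ (is_subgroup_directed_bigcup 0%N dirH sH).
have [N SHN] : exists N, S `<=` H N.
  apply: (finite_subset_directed_bigcup 0%N dirH finS).
  by rewrite -genS; exact: sub_gen_smallest.
exists N => n leNn; apply/seteqP; split; last exact: homoH.
have bigcupHN : \bigcup_i H i `<=` H N by rewrite -genS; exact: smallest_sub.
by apply: subset_trans bigcupHN; exact: bigcup_sup.
Qed.

End Subgroups.

Section RightInvariant.
Variables (G : groupType) (A : Type).
Implicit Types (D H S : set G) (x y : G -> A).

Definition right_invariant S : set (G -> A) :=
  [set x | forall g s, S s -> x (g * s)%g = x g].

Lemma shift_right_invariant S g x :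
  right_invariant S x -> right_invariant S (shift g x).
Proof. by move=> xS k s Ss; rewrite /shift mulgA; exact: xS. Qed.

Lemma right_invariant_extension D H x : is_subgroup H ->
  (forall d e, D d -> D e -> H (d^-1 * e)%g -> x e = x d) ->
  exists2 y, right_invariant H y & forall d, D d -> y d = x d.
Proof.
move=> sH xD; pose y g := x (xget 1%g (D `&` [set d | H (g^-1 * d)%g])).
exists y => [g h Hh|d Dd].
  congr (x (xget _ (_ `&` _))); apply/funext => d /=.
  by rewrite invgM -mulgA subgroupMl //; exact: subgroupV.
rewrite /y; case: xgetP => [e _ [De Hde]|/(_ d)[]]; first exact: xD.
by split=> //=; rewrite mulVg; exact: subgroup1.
Qed.

Lemma sft_right_invariant_finite_subset H :
  is_subgroup H -> sft (right_invariant H) ->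
  exists F, [/\ finite_set F, F `<=` H
    & right_invariant F `<=` right_invariant H].
Proof.
move=> sH [D [P [finD sftE]]].
exists ([set (d^-1 * e)%g | d in D & e in D] `&` H); split.
- by apply: finite_setIl; exact: finite_image2.
- exact: subIsetr.
move=> x xF; rewrite sftE => g /=.
have [|y yH yD] := @right_invariant_extension D H (shift g^-1%g x) sH.
  move=> d e Dd De Hde; rewrite -[e](mulVKg d).
  apply: shift_right_invariant xF _ _ _; split=> //.
  by exists d => //; exists e.
have := yH; rewrite sftE => /(_ 1%g) /=; congr P; apply/funext => d.
by rewrite /= {1}/shift !invg1 mul1g yD //; exact: set_valP.
Qed.

Lemma right_invariant_subgroup_sub (a b : A) H S : a <> b -> is_subgroup H ->
  right_invariant H `<=` right_invariant S -> S `<=` H.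
Proof.
move=> neq_ab sH HS s Ss.
pose x g := if g \in H then a else b.
have /HS/(_ 1%g s Ss) : right_invariant H x.
  move=> g h Hh; rewrite /x; congr (if _ then a else b).
  by apply/asbool_equiv_eq; rewrite subgroupMr.
rewrite /x mul1g (mem_set (subgroup1 sH)).
by case: ifPn => [/set_mem//|_ /esym].
Qed.

Lemma sft_right_invariant_finitely_generated (a b : A) H : a <> b ->
  is_subgroup H -> sft (right_invariant H) -> finitely_generated H.
Proof.
move=> neq_ab sH /(sft_right_invariant_finite_subset sH)[F [finF FH invFH]].
exists F; split=> //; apply/seteqP; split; first exact: smallest_sub.
apply: (right_invariant_subgroup_sub neq_ab (is_subgroup_generated F)).
apply: subset_trans invFH => x xF g s Fs.
by apply: xF; exact: sub_gen_smallest.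
Qed.

End RightInvariant.

Lemma closed_right_invariant (G : groupType) (A : choiceType) (S : set G) :
  closed (right_invariant S : set {ptws G -> discrete_topology A}).
Proof.
move=> x clx g s Ss.
have near_x k : nbhs (x : {ptws G -> discrete_topology A})
    [set y : {ptws G -> discrete_topology A} | y k = x k].
  apply: (@proj_continuous G (fun=> discrete_topology A) k x [set x k]).
  exact: discrete_set1.
have [y [yS [/= <- <-]]] := clx _ (filterI (near_x (g * s)%g) (near_x g)).
exact: yS.
Qed.

Lemma linear_subshift_right_invariant (K : fieldType) (G : groupType)
    (A : vectType K) (S : set G) :
  linear_subshift (right_invariant S : set (G -> A)).
Proof.
split; first exact: closed_right_invariant.
- by move=> g x; exact: shift_right_invariant.
- split=> [|a x y]; rewrite !inE // => xS yS g s Ss.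
  by rewrite !fctE xS // yS.
Qed.

Lemma linear_markov_type_finitely_generated (K : fieldType) (G : groupType)
    (H : set G) :
  linear_markov_type K G -> is_subgroup H -> finitely_generated H.
Proof.
move=> markov sH.
have neq01 : (0 : K^o)%R <> 1%R by apply/eqP; rewrite eq_sym oner_neq0.
apply: sft_right_invariant_finitely_generated neq01 sH _.
exact: markov (linear_subshift_right_invariant _ _).
Qed.

Theorem corollary6p1 (K : fieldType) (G : groupType) :
  linear_markov_type K G ->
  noetherian_group G /\ finitely_generated_group G.
Proof.
move=> markov.
have fg (H : set G) : is_subgroup H -> finitely_generated H.
  exact: linear_markov_type_finitely_generated markov.
split; first exact: noetherian_finitely_generated.
exact: fg (is_subgroup_setT G).
Qed.
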